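(* Let $N$ be a random variable on $\mathbb{N}_0$ and let $(X_i)_{i\ge 1}$ be an iid sequence of random variables on $\mathbb{R}_+$ with continuous distribution, independent of $N$. Let $k\in\mathbb{N}$ and assume $E N^k<\infty$. Let $S_N=\sum_{i=1}^N X_i$ and $m_k(x):=E[N^k;S_N\le x]$ for $x\ge 0$. Then for every $u\in\mathbb{R}$ the Fourier–Stieltjes transform of $m_k$ exists as an improper Riemann–Stieltjes integral and $$\int_0^\infty e^{iux}\,dm_k(x)=E\big[N^k\,\phi_{X_1}(u)^N\big]=\sum_{j=1}^{k}\left\{\begin{matrix}k\\ j\end{matrix}\right\}\big(\phi_{X_1}(u)\big)^{j}\,G_N^{(j)}\big(\phi_{X_1}(u)\big).$$
   Context: $\mathbb{N}=\{1,2,\ldots\}$, $\mathbb{N}_0=\{0,1,2,\ldots\}$, $\mathbb{R}_+=[0,\infty)$. For a random variable $Y$ and an event $A$, $E[Y;A]:=E[Y\,I_A]$, where $I_A$ is the indicator of $A$. The empty sum is $0$ (so $S_N=0$ when $N=0$), and $0^0=1$. $\phi_{X_1}(u)=E[e^{iuX_1}]$ is the characteristic function of $X_1$. ''Continuous distribution'' means that the distribution function of $X_1$ is continuous. The improper Riemann–Stieltjes integral $\int_0^\infty e^{iux}\,dm_k(x)$ is $\lim_{M\to\infty}\int_0^M e^{iux}\,dm_k(x)$. $G_N(z):=E[z^N]$ for $z\in\mathbb{C}$, $|z|\le 1$, and $G_N^{(j)}(z)$ is its $j$-th derivative at $z$; since $G_N$ is defined on the closed unit disk, at points $|z|=1$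 derivatives are taken within the closed unit disk. $\left\{\begin{matrix}k\\ j\end{matrix}\right\}$ is the Stirling number of the second kind: the number of ways of partitioning a set of $k$ elements into $j$ non-empty subsets. *)

(* Defs.v *)
From HB Require Import structures.
From mathcomp Require Import all_boot all_order all_algebra.
From mathcomp Require Import all_classical all_reals all_analysis.
From mathcomp Require Import complex.

Set Implicit Arguments.
Unset Strict Implicit.
Unset Printing Implicit Defensive.

Import Order.TTheory GRing.Theory Num.Theory.
Import numFieldNormedType.Exports.

Local Open Scope classical_set_scope.
Local Open Scope ring_scope.
Local Open Scope complex_scope.

(* The topology of R[i] is the one given by the modulus. *)
HB.instance Definition _ (R : rcfType) := NormedModule.copy R[i] R[i]^o.

Definition stirling2 (k j : nat) : nat :=
  #|[pred Q : {set {set 'I_k}} | finset.partition Q [set: 'I_k]%SET & #|Q| == j]|.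

Section complex_valued.
Context {R : realType}.

(* e^{iy} *)
Definition expi (y : R) : R[i] := cos y +i* sin y.

Definition closed_unit_disk : set R[i] := [set z | `|z| <= 1].

(* The limit is taken along points of D only, so at a boundary point of D this
   is the derivative within D. derive_in is meaningful where derivable_in
   holds. *)
Definition diff_quot (f : R[i] -> R[i]) (z w : R[i]) : R[i] :=
  (f w - f z) / (w - z).

Definition derivable_in (D : set R[i]) (f : R[i] -> R[i]) (z : R[i]) : Prop :=
  cvg (diff_quot f z w @[w --> within (D `\ z) (nbhs z)]).

Definition derive_in (D : set R[i]) (f : R[i] -> R[i]) (z : R[i]) : R[i] :=
  lim (diff_quot f z w @[w --> within (D `\ z) (nbhs z)]).

Definition nderive_in (D : set R[i]) (n : nat) (f : R[i] -> R[i]) :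
  R[i] -> R[i] := iter n (derive_in D) f.

(* The subdivision is a = x_0 < x_1 < ... < x_n = b with a :: s = x_0 ... x_n,
   and t i is the tag in [x_i, x_(i+1)]. *)
Definition RS_sum (f : R -> R[i]) (g : R -> R) (a : R) (s : seq R)
    (t : nat -> R) : R[i] :=
  \sum_(i < size s) f (t i) * (g (nth a (a :: s) i.+1) - g (nth a (a :: s) i))%:C.

Definition is_RS_integral (f : R -> R[i]) (g : R -> R) (a b : R) (l : R[i]) :
    Prop :=
  forall eps : R, 0 < eps -> exists2 delta : R, 0 < delta &
    forall (s : seq R) (t : nat -> R), itv_partition a b s ->
      (forall i, (i < size s)%N ->
        nth a (a :: s) i.+1 - nth a (a :: s) i < delta /\
        nth a (a :: s) i <= t i <= nth a (a :: s) i.+1) ->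
      `|RS_sum f g a s t - l| < eps%:C.

(* int_a^oo f dg = l *)
Definition is_improper_RS_integral (f : R -> R[i]) (g : R -> R) (a : R)
    (l : R[i]) : Prop :=
  exists2 J : R -> R[i],
    (forall M, a <= M -> is_RS_integral f g a M (J M)) &
    J M @[M --> +oo] --> l.

End complex_valued.

Section random_variables.
Context {d : measure_display} {T : measurableType d} {R : realType}.
Variable P : probability T R.

Definition cexpectation (Y : T -> R[i]) : R[i] :=
  fine 'E_P[fun w => complex.Re (Y w)] +i* fine 'E_P[fun w => complex.Im (Y w)].

Definition char_fun (Y : T -> R) (u : R) : R[i] :=
  cexpectation (fun w => expi (u * Y w)).

(* Meaningful on the closed unit disk only. *)
Definition prob_gen_fun (N : T -> nat) (z : R[i]) : R[i] :=
  cexpectation (fun w => z ^+ N w).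

Definition mutually_independent (X : nat -> {RV P >-> R}) : Prop :=
  forall (J : seq nat) (B : nat -> set R), uniq J ->
    (forall i, measurable (B i)) ->
    P (\bigcap_(i in [set` J]) (X i @^-1` B i)) =
    (\prod_(i <- J) P (X i @^-1` B i))%E.

Definition identically_distributed (X : nat -> {RV P >-> R}) : Prop :=
  forall (i j : nat) (B : set R), measurable B ->
    distribution P (X i) B = distribution P (X j) B.

Definition sigma_of_sequence (X : nat -> T -> R) : set (set T) :=
  <<s \bigcup_i preimage_set_system setT (X i) measurable >>.

Definition sequence_independent_of (X : nat -> {RV P >-> R})
    (N : {RV P >-> nat}) : Prop :=
  forall (A : set T) (B : set nat), sigma_of_sequence X A -> measurable B ->
    P (A `&` N @^-1` B) = (P A * P (N @^-1` B))%E.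

Definition random_sum (X : nat -> T -> R) (N : T -> nat) (w : T) : R :=
  \sum_(i < N w) X i w.

(* E[N^k; S <= x] *)
Definition truncated_moment (N : T -> nat) (S : T -> R) (k : nat) (x : R) : R :=
  fine 'E_P[fun w => (N w)%:R ^+ k * \1_[set w' | S w' <= x] w].

End random_variables.

Arguments mutually_independent {d T R} P X.
Arguments identically_distributed {d T R} P X.
Arguments sequence_independent_of {d T R} P X N.

(* Main.v *)
Require Import Defs.
From HB Require Import structures.
From mathcomp Require Import all_boot all_order all_algebra.
From mathcomp Require Import all_classical all_reals all_analysis.
From mathcomp Require Import complex.
From mathcomp Require Import measurable_realfun.
From mathcomp Require Import ring lra.

Import Order.TTheory GRing.Theory Num.Theory.
Import numFieldNormedType.Exports.

Local Open Scope classical_set_scope.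
Local Open Scope ring_scope.
Local Open Scope complex_scope.

(** Write X for the first X i, phi = phi_X, and E for the expectation.

    The Riemann-Stieltjes integral of x |-> e^{iux} over [0, M] against
    m(x) = E[N^k; S <= x] is E[N^k e^{iuS}; 0 < S <= M]: a Riemann-Stieltjes sum
    is the expectation of N^k times a step function of S, and the step function
    is within (2 |u|) times the mesh of e^{iuS}, because the exponential is
    Lipschitz ([is_RS_integral_expectation]).  Letting M grow leaves
    E[N^k e^{iuS}], since E N^k is finite and m(0) = 0: on {N = 0} the factor
    N^k vanishes because k > 0, and on {N > 0} the event {S <= 0} is contained
    in {X <= 0}, which is null because the distribution function of the
    nonnegative X is continuous ([is_improper_RS_integral_expectation],
    [probability_le0]).

    On the fiber {N = n} the variable S is X_0 + ... + X_(n-1), so that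
    E[e^{iuS}; N = n] = phi(u)^n P(N = n) by independence
    ([char_fun_partial_sum]).  Summing over the fibers gives
    E[N^k e^{iuS}] = E[N^k phi(u)^N] ([cexpectation_random_sum]).

    The second equality is the identity n^k = sum_j S(k, j) n^_j between powers
    and falling factorials ([expn_stirling2]), inserted under the expectation:
    phi^j G^(j)(phi) = E[N^_j phi^N], because G can be differentiated k times
    under the expectation on the closed disk ([nderive_in_prob_gen_fun]).

    Every passage to the limit rests on one fact: E[Z; V > M] is small for large
    M when Z is integrable ([exists_Rintegral_tail_lt]).  Below the threshold
    only finite sums and uniform estimates are needed. *)

(** * Complex numbers and the complex exponential *)

Section complex_numbers.
Context {R : realType}.
Implicit Types (z w : R[i]) (x y : R).

Lemma ReD z w : complex.Re (z + w) = complex.Re z + complex.Re w.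
Proof. by case: z w => [? ?] [? ?]. Qed.

Lemma ImD z w : complex.Im (z + w) = complex.Im z + complex.Im w.
Proof. by case: z w => [? ?] [? ?]. Qed.

Lemma ReM z w :
  complex.Re (z * w) = complex.Re z * complex.Re w - complex.Im z * complex.Im w.
Proof. by case: z w => [? ?] [? ?]. Qed.

Lemma ImM z w :
  complex.Im (z * w) = complex.Re z * complex.Im w + complex.Im z * complex.Re w.
Proof. by case: z w => [? ?] [? ?]. Qed.

Lemma normr_real_complex x : `|x%:C| = `|x|%:C.
Proof. by rewrite normc_def /= expr0n /= addr0 sqrtr_sqr. Qed.

Lemma ger0_norm_real_complex x : 0 <= x -> `|x%:C| = x%:C.
Proof. by move=> x0; rewrite normr_real_complex ger0_norm. Qed.

Lemma Re_le_norm z x : `|z| <= x%:C -> `|complex.Re z| <= x.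
Proof. by move=> zx; rewrite -lecR; exact: le_trans (normc_ge_Re z) zx. Qed.

Lemma Im_le_norm z x : `|z| <= x%:C -> `|complex.Im z| <= x.
Proof.
rewrite normc_def lecR; apply: le_trans.
by rewrite -sqrtr_sqr ler_wsqrtr // lerDr sqr_ge0.
Qed.

Lemma norm_real z : exists2 r : R, 0 <= r & `|z| = r%:C.
Proof. by eexists; last exact: normc_def; exact: sqrtr_ge0. Qed.

Lemma norm_small_eq z w : (forall eps : R, 0 < eps -> `|z - w| <= eps%:C) -> z = w.
Proof.
have [r r0 rE] := norm_real (z - w); rewrite rE => small.
apply/eqP; rewrite -subr_eq0 -normr_eq0 rE (fmorph_eq0 (real_complex R)).
rewrite eq_le r0 andbT; apply/ler_addgt0Pl => e e0.
by rewrite addr0 -lecR small.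
Qed.

Lemma expiD x y : expi (x + y) = expi x * expi y.
Proof. by rewrite /expi cosD sinD [X in _ +i* X]addrC. Qed.

Lemma expi0 : expi 0 = 1 :> R[i].
Proof. by rewrite /expi cos0 sin0. Qed.

Lemma norm_expi x : `|expi x| = 1.
Proof. by rewrite normc_def /= cos2Dsin2 sqrtr1. Qed.

End complex_numbers.

(** In the partial order of [R[i]] a positive element is a positive real; this
    is what turns the epsilons of limits in [R[i]] into real ones. *)
Lemma gt0_real_complex {R : realType} {e : R[i]} :
  0 < e -> exists2 r : R, 0 < r & e = r%:C.
Proof.
move=> e0; exists (complex.Re e); first by move: e0; rewrite ltcE => /andP[].
by rewrite RRe_real // gtr0_real.
Qed.

Lemma norm_imaginary {R : realType} : `|'i : R[i]| = 1.
Proof. by rewrite normc_def /= expr1n expr0n add0r sqrtr1. Qed.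

Lemma norm_indic {T : Type} {R : realType} (A : set T) (w : T) :
  `|\1_A w| <= 1 :> R.
Proof. by rewrite indicE; case: (_ \in _); rewrite ?normr1 ?normr0. Qed.

Lemma norm_indicC {T : Type} {R : realType} (A : set T) (w : T) :
  `|(\1_A w)%:C| <= 1 :> R[i].
Proof. by rewrite normr_real_complex lecR norm_indic. Qed.

Lemma lipschitz_derive_le1 {R : realType} (f df : R -> R) :
  (forall x : R, is_derive x 1 f (df x)) -> (forall x, `|df x| <= 1) ->
  forall x y, `|f x - f y| <= `|x - y|.
Proof.
move=> fdf df1 x y; wlog xy : x y / x <= y.
  by move=> h; have [/h//|/ltW/h] := leP x y; rewrite distrC (distrC y).
have cf : {within `[x, y], continuous f}.
  apply: continuous_subspaceT => z.
  by apply/differentiable_continuous/derivable1_diffP; case: (fdf z).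
have [c _ fE] := MVT_segment xy (fun z _ => fdf z) cf.
by rewrite distrC fE normrM (distrC x) ler_piMl.
Qed.

(** The constant is 2, not the optimal 1, because cosine and sine are estimated
    separately. *)
Lemma expi_lipschitz {R : realType} (x y : R) :
  `|expi x - expi y| <= (2 * `|x - y|)%:C.
Proof.
have -> : expi x - expi y = (cos x - cos y)%:C + 'i * (sin x - sin y)%:C.
  exact: complexE.
apply: le_trans (ler_normD _ _) _.
rewrite normrM !normr_real_complex norm_imaginary mul1r -rmorphD lecR.
rewrite mulr_natl mulr2n.
apply: lerD.
  apply: (lipschitz_derive_le1 cos (fun x => - sin x)) => z.
  by rewrite normrN ler_norml sin_geN1 sin_le1.
apply: (lipschitz_derive_le1 sin cos) => z.
by rewrite ler_norml cos_geN1 cos_le1.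
Qed.

(** * Expectation of complex random variables *)

Section complex_expectation.
Context {d : measure_display} {T : measurableType d} {R : realType}.
Variable P : probability T R.
Implicit Types (Y : T -> R[i]) (Z f : T -> R).

Definition cmeasurable Y :=
  measurable_fun setT (fun w => complex.Re (Y w)) /\
  measurable_fun setT (fun w => complex.Im (Y w)).

Definition cintegrable Y :=
  P.-integrable setT (EFin \o (fun w => complex.Re (Y w))) /\
  P.-integrable setT (EFin \o (fun w => complex.Im (Y w))).

Lemma cmeasurableM Y1 Y2 : cmeasurable Y1 -> cmeasurable Y2 ->
  cmeasurable (fun w => Y1 w * Y2 w).
Proof.
move=> [r1 i1] [r2 i2]; split.
  under eq_fun do rewrite ReM.
  by apply: measurable_funB; apply: measurable_funM.
under eq_fun do rewrite ImM.
by apply: measurable_funD; apply: measurable_funM.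
Qed.

Lemma cmeasurableD Y1 Y2 : cmeasurable Y1 -> cmeasurable Y2 ->
  cmeasurable (fun w => Y1 w + Y2 w).
Proof.
move=> [r1 i1] [r2 i2]; split.
  by under eq_fun do rewrite ReD; exact: measurable_funD.
by under eq_fun do rewrite ImD; exact: measurable_funD.
Qed.

Lemma cmeasurable_cst z : cmeasurable (fun=> z).
Proof. by split; exact: measurable_cst. Qed.

Lemma cmeasurable_real f : measurable_fun setT f ->
  cmeasurable (fun w => (f w)%:C).
Proof. by move=> mf; split => //=; exact: measurable_cst. Qed.

Lemma cmeasurableB Y1 Y2 : cmeasurable Y1 -> cmeasurable Y2 ->
  cmeasurable (fun w => Y1 w - Y2 w).
Proof.
move=> m1 m2; under eq_fun do rewrite -mulN1r.
by apply: cmeasurableD => //; apply: cmeasurableM => //; exact: cmeasurable_cst.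
Qed.

Lemma cmeasurable_expi f : measurable_fun setT f ->
  cmeasurable (fun w => expi (f w)).
Proof.
move=> mf; split => /=; apply: measurableT_comp => //.
  by apply: continuous_measurable_fun; exact: continuous_cos.
by apply: continuous_measurable_fun; exact: continuous_sin.
Qed.

Lemma cmeasurable_nat (h : nat -> R[i]) (N : {mfun T >-> nat}) :
  cmeasurable (fun w => h (N w)).
Proof. by split; apply: (measurableT_comp (f := fun n => _ (h n))). Qed.

Lemma integrable_dominated f Z : measurable_fun setT f ->
  P.-integrable setT (EFin \o Z) -> (forall w, `|f w| <= Z w) ->
  P.-integrable setT (EFin \o f).
Proof.
move=> mf iZ fZ; apply: le_integrable iZ => //; first exact/measurable_EFinP.
by move=> w _ /=; rewrite lee_fin (le_trans (fZ w)) // ler_norm.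
Qed.

Lemma integrable_mul_indic Z (A : set T) : P.-integrable setT (EFin \o Z) ->
  measurable A -> P.-integrable setT (EFin \o (fun w => Z w * \1_A w)).
Proof.
move=> iZ mA; have /integrableP[/measurable_EFinP mZ _] := iZ.
apply: (integrable_dominated _ (fun w => `|Z w|)).
- by apply: measurable_funM => //; exact: measurable_indic.
- exact: integrable_norm.
- by move=> w; rewrite normrM ler_piMr // norm_indic.
Qed.

Lemma cintegrable_dominated Y Z : cmeasurable Y ->
  P.-integrable setT (EFin \o Z) -> (forall w, `|Y w| <= (Z w)%:C) ->
  cintegrable Y.
Proof.
move=> [mr mi] iZ YZ; split; apply: (integrable_dominated _ Z) => // w.
  exact: Re_le_norm.
exact: Im_le_norm.
Qed.

Lemma cintegrable_real f : P.-integrable setT (EFin \o f) ->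
  cintegrable (fun w => (f w)%:C).
Proof. by move=> fi; split => //=; exact: integrable0. Qed.

Lemma integrable_addr f g : P.-integrable setT (EFin \o f) ->
  P.-integrable setT (EFin \o g) ->
  P.-integrable setT (EFin \o (fun w => f w + g w)).
Proof. by move=> fi gi; exact: (integrableD measurableT fi gi). Qed.

Lemma integrable_scaler (c : R) f : P.-integrable setT (EFin \o f) ->
  P.-integrable setT (EFin \o (fun w => c * f w)).
Proof. by move=> fi; exact: (integrableZl measurableT c fi). Qed.

Lemma cexpectationE Y : cexpectation P Y =
  (\int[P]_w complex.Re (Y w)) +i* (\int[P]_w complex.Im (Y w)).
Proof. by rewrite /cexpectation unlock. Qed.

Lemma eq_cexpectation Y1 Y2 : Y1 =1 Y2 -> cexpectation P Y1 = cexpectation P Y2.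
Proof. by move=> /funext ->. Qed.

Lemma cexpectation_real f :
  cexpectation P (fun w => (f w)%:C) = (\int[P]_w f w)%:C.
Proof.
by rewrite cexpectationE /= Rintegral_cst // mul0r.
Qed.

Lemma Rintegral_probability_cst (r : R) : \int[P]_w r = r.
Proof.
rewrite (Rintegral_cst P measurableT) -[RHS]mulr1; congr (_ * _).
exact: (congr1 fine (probability_setT P)).
Qed.

Lemma cexpectation_indic (A : set T) : measurable A ->
  cexpectation P (fun w => (\1_A w)%:C) = (fine (P A))%:C.
Proof.
by move=> mA; rewrite cexpectation_real /Rintegral integral_indic // setIT.
Qed.

Lemma cintegrableD Y1 Y2 : cintegrable Y1 -> cintegrable Y2 ->
  cintegrable (fun w => Y1 w + Y2 w).
Proof.
move=> [r1 i1] [r2 i2]; split.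
  by under eq_fun do rewrite ReD; exact: integrable_addr.
by under eq_fun do rewrite ImD; exact: integrable_addr.
Qed.

Lemma cexpectationD Y1 Y2 : cintegrable Y1 -> cintegrable Y2 ->
  cexpectation P (fun w => Y1 w + Y2 w) =
    cexpectation P Y1 + cexpectation P Y2.
Proof.
move=> [r1 i1] [r2 i2]; rewrite !cexpectationE.
apply/eqP; rewrite eq_complex /= -!RintegralD //.
apply/andP; split; apply/eqP; apply: eq_Rintegral => w _; first by rewrite ReD.
by rewrite ImD.
Qed.

Lemma cintegrableZ (z : R[i]) Y : cintegrable Y ->
  cintegrable (fun w => z * Y w).
Proof.
move=> [r i]; split.
  under eq_fun do rewrite ReM -mulNr.
  by apply: integrable_addr; exact: integrable_scaler.
under eq_fun do rewrite ImM.
by apply: integrable_addr; exact: integrable_scaler.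
Qed.

Lemma cexpectationZ (z : R[i]) Y : cintegrable Y ->
  cexpectation P (fun w => z * Y w) = z * cexpectation P Y.
Proof.
move=> [r i]; rewrite !cexpectationE.
have sc c f := integrable_scaler c f.
apply/eqP; rewrite eq_complex /= ReM ImM /= -!mulNr -!RintegralZl // -!RintegralD.
- apply/andP; split; apply/eqP; apply: eq_Rintegral => w _.
    by rewrite ReM mulNr.
  by rewrite ImM.
all: by [|exact: sc].
Qed.

Lemma cintegrableB Y1 Y2 : cintegrable Y1 -> cintegrable Y2 ->
  cintegrable (fun w => Y1 w - Y2 w).
Proof.
move=> i1 i2; under eq_fun do rewrite -mulN1r.
by apply: cintegrableD => //; exact: cintegrableZ.
Qed.

Lemma cexpectationB Y1 Y2 : cintegrable Y1 -> cintegrable Y2 ->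
  cexpectation P (fun w => Y1 w - Y2 w) =
    cexpectation P Y1 - cexpectation P Y2.
Proof.
move=> i1 i2; under eq_fun do rewrite -mulN1r.
rewrite cexpectationD //; last exact: cintegrableZ.
by rewrite cexpectationZ // mulN1r.
Qed.

Lemma cintegrable0 : cintegrable (fun=> 0).
Proof. by split; exact: integrable0. Qed.

Lemma cintegrable_sum (I : Type) (s : seq I) (F : I -> T -> R[i]) :
  (forall i, cintegrable (F i)) ->
  cintegrable (fun w => \sum_(i <- s) F i w).
Proof.
move=> Fi; elim: s => [|i s IH].
  by under eq_fun do rewrite big_nil; exact: cintegrable0.
by under eq_fun do rewrite big_cons; exact: cintegrableD.
Qed.

Lemma cexpectation_sum (I : Type) (s : seq I) (F : I -> T -> R[i]) :
  (forall i, cintegrable (F i)) ->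
  cexpectation P (fun w => \sum_(i <- s) F i w) =
    \sum_(i <- s) cexpectation P (F i).
Proof.
move=> Fi; elim: s => [|i s IH].
  under eq_cexpectation do rewrite big_nil.
  by rewrite big_nil (cexpectation_real (fun=> 0)) Rintegral_cst // mul0r.
under eq_cexpectation do rewrite big_cons.
by rewrite cexpectationD ?IH ?big_cons //; exact: cintegrable_sum.
Qed.

(** The triangle inequality for the integral.  Bounding the real and imaginary
    parts separately would lose a factor; instead, with e = E Y, the number
    |e|^2 is the expectation of the real part of e^* Y, which is at most |e| Z. *)
Lemma norm_cexpectation_le Y Z : cintegrable Y ->
  P.-integrable setT (EFin \o Z) -> (forall w, `|Y w| <= (Z w)%:C) ->
  `|cexpectation P Y| <= (\int[P]_w Z w)%:C.
Proof.
move=> Yi Zi YZ; set e := cexpectation P Y.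
have [->|e0] := eqVneq e 0.
  rewrite normr0 lecR; apply: Rintegral_ge0 => w _.
  by rewrite -lecR; apply: le_trans (YZ w); exact: normr_ge0.
have nE : `|e| = (Num.sqrt (complex.Re e ^+ 2 + complex.Im e ^+ 2))%:C.
  exact: normc_def.
set r := Num.sqrt _ in nE.
have r_gt0 : 0 < r by rewrite -ltcR -nE normr_gt0.
rewrite nE lecR -(ler_pM2l r_gt0) -RintegralZl //.
have -> : r * r = complex.Re (cexpectation P (fun w => e^* * Y w)).
  rewrite cexpectationZ // -/e -expr2 mulrC -sqr_normc nE.
  by rewrite -rmorphXn.
have [Ri _] := cintegrableZ e^* Y Yi.
rewrite cexpectationE /=; apply: le_Rintegral => // [|w _].
  exact: integrable_scaler.
apply: le_trans (ler_norm _) _; apply: Re_le_norm.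
by rewrite normrM normcJ nE rmorphM /= ler_wpM2l // ler0c ltW.
Qed.

Lemma cintegrable_bounded Y (r : R) : cmeasurable Y ->
  (forall w, `|Y w| <= r%:C) -> cintegrable Y.
Proof.
move=> mY Yr; apply: (cintegrable_dominated Y (cst r)) => //.
exact: finite_measure_integrable_cst.
Qed.

Lemma norm_cexpectation_le_cst Y (r : R) : cmeasurable Y ->
  (forall w, `|Y w| <= r%:C) -> `|cexpectation P Y| <= r%:C.
Proof.
move=> mY Yr; rewrite -(Rintegral_probability_cst r).
apply: norm_cexpectation_le => //; first exact: cintegrable_bounded mY Yr.
exact: finite_measure_integrable_cst.
Qed.

End complex_expectation.

Lemma measurable_setle {d : measure_display} {T : measurableType d}
    {R : realType} (S : T -> R) (x : R) :
  measurable_fun setT S -> measurable [set w | S w <= x].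
Proof.
move=> mS; have := mS measurableT `]-oo, x]%classic (measurable_itv _).
by rewrite setTI; congr measurable; apply/seteqP; split => w /=;
  rewrite in_itv.
Qed.

Lemma measurable_setlt {d : measure_display} {T : measurableType d}
    {R : realType} (S : T -> R) (x : R) :
  measurable_fun setT S -> measurable [set w | x < S w].
Proof.
move=> mS; have := mS measurableT `]x, +oo[%classic (measurable_itv _).
by rewrite setTI; congr measurable; apply/seteqP; split => w /=;
  rewrite in_itv /= andbT.
Qed.

(** Dominated convergence: Z 1_{n < V} tends to 0 pointwise, below Z. *)
Lemma exists_Rintegral_tail_lt {d : measure_display} {T : measurableType d}
    {R : realType} (P : probability T R) (Z V : T -> R) (eps : R) :
  P.-integrable setT (EFin \o Z) -> (forall w, 0 <= Z w) ->
  measurable_fun setT V -> 0 < eps ->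
  exists K : nat, forall M : R, K%:R <= M ->
    \int[P]_w (Z w * \1_[set x | M < V x] w) < eps.
Proof.
move=> iZ Z0 mV eps0.
have itail M := integrable_mul_indic P _ _ iZ (measurable_setlt V M mV).
have [] := @dominated_convergence _ _ _ P setT measurableT
  (fun n w => (Z w * \1_[set x | n%:R < V x] w)%:E) (cst 0%E) (EFin \o Z).
- by move=> n; case/integrableP: (itail n%:R).
- exact: measurable_cst.
- apply/aeW => w _; apply: cvg_near_cst; near=> n.
  rewrite indicE memNset ?mulr0 //=.
  apply/negP; rewrite -leNgt; apply/ltW.
  by near: n; exact: nbhs_infty_gtr.
- exact: iZ.
- apply/aeW => w n _.
  by rewrite lee_fin normrM ger0_norm // ler_piMr // norm_indic.
rewrite integral0 => _ _ /fine_cvg /cvgr0_norm_lt /(_ _ eps0)[K _ KP].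
exists K => M KM; apply: le_lt_trans (KP K (leqnn _)).
apply: le_trans (ler_norm _); apply: le_Rintegral => // w _.
rewrite ler_wpM2l // !indicE ler_nat.
have [/set_mem /= MV|//] := boolP (w \in [set x | M < V x]).
by rewrite mem_set //=; exact: le_lt_trans MV.
Unshelve. all: by end_near. Qed.

(** * Characteristic function of the random sum *)

(** Independence and equality of laws are both instances of the hypothesis on
    indicators: W carries the information independent of Y, c is its mean, and
    Y' is another variable with the law of Y.  It passes from indicators to a
    bounded g by uniform approximation: g is cut into the level sets
    {l/m - 1 <= g < (l+1)/m - 1}, which costs 1/m on the side of Y and |c|/m on
    the side of Y'. *)
Lemma cexpectation_transfer {d : measure_display} {T : measurableType d}
    {R : realType} (P : probability T R) (W : T -> R[i]) (c : R[i])
    (Y Y' : {RV P >-> R}) (g : R -> R) :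
  cmeasurable W -> (forall w, `|W w| <= 1) ->
  (forall B, measurable B ->
    cexpectation P (fun w => W w * (\1_(Y @^-1` B) w)%:C) =
      c * (fine (P (Y' @^-1` B)))%:C) ->
  measurable_fun setT g -> (forall y, `|g y| <= 1) ->
  cexpectation P (fun w => W w * (g (Y w))%:C) =
    c * cexpectation P (fun w => (g (Y' w))%:C).
Proof.
move=> mW W1 WB mg g1; apply: norm_small_eq => eps eps0.
have [rc rc0 rcE] := norm_real c.
pose m := (Num.truncn ((1 + rc) / eps)).+1.
have m0 : 0 < m%:R :> R by rewrite ltr0n.
(* g is bounded by 1, so h takes its values in [0, 2m]; phi y is the index of
   the level set of y and a (phi y) the value of the approximation. *)
pose h y := m%:R * (g y + 1).
have h0 y : 0 <= h y.
  by rewrite mulr_ge0 //; have := g1 y; rewrite ler_norml => /andP[? ?]; lra.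
pose phi y := Num.truncn (h y).
pose a (l : nat) : R := l%:R / m%:R - 1.
have phiP y l : (phi y == l) = (l%:R <= h y < l.+1%:R) by exact: truncn_eq.
have phi_lt y : (phi y < (m + m).+1)%N.
  have := phiP y (phi y); rewrite eqxx => /esym /andP[+ _].
  have : h y <= (m + m)%:R.
    rewrite natrD /h; have := g1 y; rewrite ler_norml => /andP[? ?]; nra.
  by move=> /[swap] /le_trans /[apply]; rewrite ler_nat ltnS.
have aphi y : `|g y - a (phi y)| <= m%:R^-1.
  have := phiP y (phi y); rewrite eqxx => /esym; rewrite -natr1.
  have -> : g y - a (phi y) = (h y - (phi y)%:R) / m%:R.
    by rewrite /a /h; field; rewrite gt_eqF.
  rewrite normf_div (gtr0_norm m0) ler_pdivrMr // mulVf ?gt_eqF //.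
  by move=> /andP[? ?]; rewrite ler_norml; apply/andP; split; lra.
pose D l := [set y | phi y = l].
have mD l : measurable (D l).
  have mh : measurable_fun setT h.
    apply: measurable_funM; first exact: measurable_cst.
    by apply: measurable_funD => //; exact: measurable_cst.
  have := mh measurableT `[l%:R, l.+1%:R[%classic (measurable_itv _).
  rewrite setTI; congr measurable; apply/seteqP; split => x /=.
    by rewrite in_itv /= -phiP => /eqP.
  by rewrite in_itv /= -phiP => /eqP.
have aphiE y : a (phi y) = \sum_(l < (m + m).+1) a l * \1_(D l) y.
  rewrite (bigD1 (Ordinal (phi_lt y))) //= indicE mem_set // mulr1.
  rewrite big1 ?addr0 // => l /eqP lP; rewrite indicE memNset ?mulr0 //.
  by move=> /= yl; apply: lP; exact/val_inj.
have mcomp (f : R -> R) (U : {RV P >-> R}) : measurable_fun setT f ->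
    measurable_fun setT (fun w => f (U w)).
  by move=> mf; exact: measurableT_comp.
have maphi : measurable_fun setT (fun y => a (phi y)).
  under eq_fun do rewrite aphiE.
  apply: measurable_sum => l; apply: measurable_funM; first exact: measurable_cst.
  exact: measurable_indic.
have mWf (V : T -> R[i]) (f : R -> R) (U : {RV P >-> R}) : cmeasurable V ->
    measurable_fun setT f -> cmeasurable (fun w => V w * (f (U w))%:C).
  by move=> mV mf; apply: cmeasurableM => //; apply: cmeasurable_real; exact: mcomp.
have WfE (V : T -> R[i]) (f : R -> R) (U : {RV P >-> R}) (r : R) :
    (forall w, `|V w| <= 1) -> (forall y, `|f y| <= r) ->
    forall w, `|V w * (f (U w))%:C| <= r%:C.
  move=> V1 fr w; rewrite normrM -[leRHS]mul1r ler_pM //.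
  by rewrite normr_real_complex lecR.
have stepE (V : T -> R[i]) (U : {RV P >-> R}) : cmeasurable V ->
    (forall w, `|V w| <= 1) ->
    cexpectation P (fun w => V w * (a (phi (U w)))%:C) =
    \sum_(l < (m + m).+1)
      (a l)%:C * cexpectation P (fun w => V w * (\1_(U @^-1` D l) w)%:C).
  move=> mV V1.
  have Vi l : cintegrable P (fun w => V w * (\1_(D l) (U w))%:C).
    apply: (@cintegrable_bounded _ _ _ P _ 1).
      by apply: mWf => //; exact: measurable_indic.
    by apply: WfE => // y; exact: norm_indic.
  transitivity (cexpectation P (fun w => \sum_(l < (m + m).+1)
      (a l)%:C * (V w * (\1_(D l) (U w))%:C))).
    apply: eq_cexpectation => w; rewrite aphiE rmorph_sum mulr_sumr.
    by apply: eq_bigr => l _; rewrite rmorphM /= mulrCA.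
  rewrite cexpectation_sum => [|l]; last exact: cintegrableZ.
  by apply: eq_bigr => l _; rewrite cexpectationZ.
have diffE (V : T -> R[i]) (U : {RV P >-> R}) : cmeasurable V ->
    (forall w, `|V w| <= 1) ->
    `|cexpectation P (fun w => V w * (g (U w))%:C) -
      cexpectation P (fun w => V w * (a (phi (U w)))%:C)| <= (m%:R^-1)%:C.
  move=> mV V1; have Vg := mWf V _ U mV mg; have Va := mWf V _ U mV maphi.
  have a2 y : `|a (phi y)| <= 1 + m%:R^-1.
    have := g1 y; have := aphi y; rewrite !ler_norml => /andP[? ?] /andP[? ?].
    by apply/andP; split; lra.
  have ig := cintegrable_bounded P _ 1 Vg (WfE V g U 1 V1 g1).
  have ia := cintegrable_bounded P _ _ Va (WfE V (fun y => a (phi y)) U _ V1 a2).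
  rewrite -cexpectationB //.
  apply: norm_cexpectation_le_cst; first exact: cmeasurableB.
  move=> w; rewrite -mulrBr -rmorphB; exact: (WfE V (fun y => g y - a (phi y))).
have one1 (w : T) : `|1 : R[i]| <= 1 by rewrite normr1.
have mone := @cmeasurable_cst _ T _ (1 : R[i]).
have eqc : cexpectation P (fun w => W w * (a (phi (Y w)))%:C) =
    c * cexpectation P (fun w => 1 * (a (phi (Y' w)))%:C).
  rewrite !stepE // mulr_sumr; apply: eq_bigr => l _.
  rewrite WB // mulrCA; congr (_ * (_ * _)).
  under eq_cexpectation do rewrite mul1r.
  by rewrite cexpectation_indic //; exact: measurable_funPTI.
have -> : cexpectation P (fun w => (g (Y' w))%:C) =
    cexpectation P (fun w => 1 * (g (Y' w))%:C).
  by apply: eq_cexpectation => w; rewrite mul1r.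
apply: (@le_trans _ _ ((1 + rc) / m%:R)%:C); last first.
  rewrite lecR ler_pdivrMr // mulrC -ler_pdivrMr //; apply/ltW.
  exact: truncnS_gt.
rewrite -(subrKA (cexpectation P (fun w => W w * (a (phi (Y w)))%:C))).
apply: le_trans (ler_normD _ _) _.
rewrite mulrDl mul1r rmorphD lerD ?diffE // eqc -mulrBr normrM rcE rmorphM /=.
by rewrite ler_wpM2l ?ler0c // distrC diffE.
Qed.

Lemma cexpectation_transfer_expi {d : measure_display} {T : measurableType d}
    {R : realType} (P : probability T R) (W : T -> R[i]) (c : R[i])
    (Y Y' : {RV P >-> R}) (u : R) :
  cmeasurable W -> (forall w, `|W w| <= 1) ->
  (forall B, measurable B ->
    cexpectation P (fun w => W w * (\1_(Y @^-1` B) w)%:C) =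
      c * (fine (P (Y' @^-1` B)))%:C) ->
  cexpectation P (fun w => W w * expi (u * Y w)) = c * char_fun P Y' u.
Proof.
move=> mW W1 WB.
have mu (f : R -> R) : continuous f -> measurable_fun setT (fun y => f (u * y)).
  move=> cf; apply: measurableT_comp; first exact: continuous_measurable_fun.
  by apply: measurable_funM; first exact: measurable_cst.
have Wcos := cexpectation_transfer P W c Y Y' (fun y => cos (u * y))
  mW W1 WB (mu _ (@continuous_cos R)).
have Wsin := cexpectation_transfer P W c Y Y' (fun y => sin (u * y))
  mW W1 WB (mu _ (@continuous_sin R)).
have iE (U : {RV P >-> R}) (V : T -> R[i]) (f : R -> R) :
    continuous f -> (forall y, `|f y| <= 1) -> cmeasurable V ->
    (forall w, `|V w| <= 1) -> cintegrable P (fun w => V w * (f (u * U w))%:C).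
  move=> cf f1 mV V1; apply: (cintegrable_bounded P _ 1) => [|w].
    apply: cmeasurableM => //; apply: cmeasurable_real.
    exact: (measurableT_comp (mu f cf)).
  by rewrite normrM normr_real_complex -[leRHS]mulr1 ler_pM // lecR.
have cos1 y : `|cos y| <= 1 :> R by rewrite ler_norml cos_geN1 cos_le1.
have sin1 y : `|sin y| <= 1 :> R by rewrite ler_norml sin_geN1 sin_le1.
have expiE (V : T -> R[i]) (U : {RV P >-> R}) : cmeasurable V ->
    (forall w, `|V w| <= 1) -> cexpectation P (fun w => V w * expi (u * U w)) =
    cexpectation P (fun w => V w * (cos (u * U w))%:C) +
    'i * cexpectation P (fun w => V w * (sin (u * U w))%:C).
  move=> mV V1; rewrite -cexpectationZ; last exact: iE (@continuous_sin R) _ _ _.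
  rewrite -cexpectationD; last 2 first.
  - exact: iE (@continuous_cos R) _ _ _.
  - by apply: cintegrableZ; exact: iE (@continuous_sin R) _ _ _.
  apply: eq_cexpectation => w; rewrite mulrCA -mulrDr; congr (_ * _).
  exact: complexE.
rewrite expiE // Wcos // Wsin // mulrCA -mulrDr; congr (_ * _).
transitivity (cexpectation P (fun w => 1 * expi (u * Y' w))); last first.
  by apply: eq_cexpectation => w; rewrite mul1r.
rewrite expiE; last 2 first.
- exact: cmeasurable_cst.
- by move=> w; rewrite normr1.
by congr (_ + _ * _); apply: eq_cexpectation => w; rewrite mul1r.
Qed.

Section random_sum_transform.
Context {d : measure_display} {T : measurableType d} {R : realType}.
Variable P : probability T R.
Variables (N : {RV P >-> nat}) (X : nat -> {RV P >-> R}).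
Hypothesis X_indep : mutually_independent P X.
Hypothesis X_ident : identically_distributed P X.
Hypothesis XN_indep : sequence_independent_of P X N.

(** The constraints start at index j: the induction below moves the factors
    e^{iuX_i} with i < j out of the event, one index at a time. *)
Definition cylinder (n j : nat) (B : nat -> set R) : set T :=
  \bigcap_(i in [set` iota j (n - j)]) (X i @^-1` B i) `&` N @^-1` [set n].

Lemma measurable_cylinder n j B :
  (forall i, measurable (B i)) -> measurable (cylinder n j B).
Proof.
move=> mB; apply: measurableI; last exact: measurable_funPTI.
rewrite bigcap_mkcond; apply: bigcapT_measurable => i.
by case: ifP => // _; exact: measurable_funPTI.
Qed.

Lemma probability_cylinder n j B : (forall i, measurable (B i)) ->
  P (cylinder n j B) =
    ((\prod_(i <- iota j (n - j)) P (X i @^-1` B i)) * P (N @^-1` [set n]))%E.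
Proof.
move=> mB; rewrite XN_indep //.
  by rewrite X_indep //; exact: iota_uniq.
have [sX0 sXC sXU] : sigma_algebra setT (sigma_of_sequence X).
  exact: smallest_sigma_algebra.
have XB i : sigma_of_sequence X (X i @^-1` B i).
  apply: sub_gen_smallest; exists i => //; exists (B i) => //.
  by rewrite setTI.
rewrite bigcap_mkcond -[X in sigma_of_sequence _ X]setCK setC_bigcap -setTD.
apply: (sXC); apply: (sXU) => i; rewrite -setTD; apply: (sXC).
by case: ifP => // _; rewrite -[setT]setD0; exact: (sXC).
Qed.

Lemma sum_measurable n : measurable_fun setT (fun w => \sum_(i < n) X i w).
Proof. by apply: measurable_sum => i; exact: measurable_funP. Qed.

Lemma probability_cylinderS n j B (C : set R) : (j < n)%N ->
  (forall i, measurable (B i)) -> measurable C ->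
  P (cylinder n j (fun i => if i == j then C else B i)) =
    (P (X 0%N @^-1` C) * P (cylinder n j.+1 B))%E.
Proof.
move=> jn mB mC; have mB' i : measurable (if i == j then C else B i) by case: eqP.
rewrite !probability_cylinder // -(subnSK jn) /= big_cons eqxx muleA.
have -> : P (X j @^-1` C) = P (X 0%N @^-1` C) by exact: X_ident.
congr (_ * _ * _)%E; apply: eq_big_seq => i; rewrite mem_iota => /andP[ji _].
by rewrite gtn_eqF.
Qed.

Lemma cylinderS n j B (C : set R) : (j < n)%N ->
  cylinder n j (fun i => if i == j then C else B i) =
    X j @^-1` C `&` cylinder n j.+1 B.
Proof.
move=> jn; rewrite /cylinder setIA; congr (_ `&` _).
apply/seteqP; split => w /=.
  move=> h; split.
    by have := h j; rewrite /= -(subnSK jn) /= mem_head eqxx; exact.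
  move=> i /= ij; have := h i; rewrite /= -(subnSK jn) /= in_cons ij orbT.
  by move: ij; rewrite mem_iota => /andP[ij _]; rewrite gtn_eqF //; exact.
move=> [Cw h] i /=; rewrite -(subnSK jn) /= in_cons.
by case: eqP => [->|_] //= /h.
Qed.

(** Keeping the event on the remaining variables arbitrary is what makes the
    induction go through without product measures or generated sigma-algebras:
    to extract X_j, the induction hypothesis is applied to the cylinder with the
    extra constraint X_j in C, and its two sides provide the hypothesis of
    [cexpectation_transfer_expi]. *)
Lemma char_fun_partial_sum (u : R) n j B : (j <= n)%N ->
  (forall i, measurable (B i)) ->
  cexpectation P (fun w => expi (u * \sum_(i < j) X i w) *
                           (\1_(cylinder n j B) w)%:C) =
    char_fun P (X 0%N) u ^+ j * (fine (P (cylinder n j B)))%:C.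
Proof.
elim: j B => [|j IH] B jn mB.
  rewrite mul1r -cexpectation_indic; last exact: measurable_cylinder.
  by apply: eq_cexpectation => w; rewrite big_ord0 mulr0 expi0 mul1r.
pose W w := expi (u * \sum_(i < j) X i w) * (\1_(cylinder n j.+1 B) w)%:C.
pose c := char_fun P (X 0%N) u ^+ j * (fine (P (cylinder n j.+1 B)))%:C.
have mW : cmeasurable W.
  apply: cmeasurableM.
    apply: cmeasurable_expi; apply: measurable_funM; first exact: measurable_cst.
    exact: sum_measurable.
  by apply: cmeasurable_real; apply: measurable_indic; exact: measurable_cylinder.
have W1 w : `|W w| <= 1.
  by rewrite /W normrM norm_expi mul1r norm_indicC.
have WB C : measurable C ->
    cexpectation P (fun w => W w * (\1_(X j @^-1` C) w)%:C) =
      c * (fine (P (X 0%N @^-1` C)))%:C.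
  move=> mC; transitivity (cexpectation P (fun w =>
      expi (u * \sum_(i < j) X i w) *
      (\1_(cylinder n j (fun i => if i == j then C else B i)) w)%:C)).
    apply: eq_cexpectation => w; rewrite /W -mulrA -rmorphM /= cylinderS //.
    by rewrite setIC (indicI _ (cylinder n j.+1 B)).
  rewrite IH ?(ltnW jn) // => [|i]; last by case: eqP.
  have fC : P (X 0%N @^-1` C) \is a fin_num.
    by apply: fin_num_measure; exact: measurable_funPTI.
  have fB : P (cylinder n j.+1 B) \is a fin_num.
    by apply: fin_num_measure; exact: measurable_cylinder.
  rewrite probability_cylinderS // fineM //.
  by rewrite rmorphM /= mulrCA mulrC /c.
rewrite exprSr mulrAC -/c.
rewrite -(cexpectation_transfer_expi P W c (X j) (X 0%N) u mW W1 WB).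
apply: eq_cexpectation => w.
by rewrite /W big_ord_recr mulrDr expiD mulrAC.
Qed.

Lemma char_fun_sum_fiber (u : R) n :
  cexpectation P (fun w => expi (u * \sum_(i < n) X i w) *
                           (\1_(N @^-1` [set n]) w)%:C) =
    char_fun P (X 0%N) u ^+ n * (fine (P (N @^-1` [set n])))%:C.
Proof.
have := char_fun_partial_sum u n n (fun=> setT) (leqnn n) (fun=> measurableT).
have -> // : cylinder n n (fun=> setT) = N @^-1` [set n].
by rewrite /cylinder; apply/seteqP; split => w [].
Qed.

End random_sum_transform.

(** The difference of the expectations is its part on {N > K}, which is at most
    E[2 Z; N > K], because finitely many fibers contribute 0. *)
Lemma eq_cexpectation_fibers {d : measure_display} {T : measurableType d}
    {R : realType} (P : probability T R) (N : {RV P >-> nat}) (Y1 Y2 : T -> R[i])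
    (Z : T -> R) :
  cmeasurable Y1 -> cmeasurable Y2 -> P.-integrable setT (EFin \o Z) ->
  (forall w, `|Y1 w| <= (Z w)%:C) -> (forall w, `|Y2 w| <= (Z w)%:C) ->
  (forall n, cexpectation P (fun w => Y1 w * (\1_(N @^-1` [set n]) w)%:C) =
             cexpectation P (fun w => Y2 w * (\1_(N @^-1` [set n]) w)%:C)) ->
  cexpectation P Y1 = cexpectation P Y2.
Proof.
move=> m1 m2 iZ Y1Z Y2Z Y12; apply: norm_small_eq => eps eps0.
pose D w := Y1 w - Y2 w.
have mD : cmeasurable D by exact: cmeasurableB.
have i1 := cintegrable_dominated P Y1 Z m1 iZ Y1Z.
have i2 := cintegrable_dominated P Y2 Z m2 iZ Y2Z.
pose Z2 w := 2 * Z w.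
have iZ2 : P.-integrable setT (EFin \o Z2) by exact: integrable_scaler.
have DZ w : `|D w| <= (Z2 w)%:C.
  apply: le_trans (ler_normB _ _) _.
  by rewrite /Z2 mulr_natl mulr2n rmorphD lerD.
have Z20 w : 0 <= Z2 w by rewrite -lecR; apply: le_trans (DZ w); exact: normr_ge0.
have mN : measurable_fun setT (fun w => (N w)%:R : R).
  exact: (measurableT_comp (f := fun n : nat => n%:R : R)).
have [K /(_ _ (lexx _)) tailK] :=
  exists_Rintegral_tail_lt P Z2 (fun w => (N w)%:R) eps iZ2 Z20 mN eps0.
rewrite -cexpectationB //.
have mF n : measurable (N @^-1` [set n]).
  exact: measurable_funPTI.
pose A : set T := [set w | K%:R < (N w)%:R :> R].
have mA : measurable A by exact: (measurable_setlt _ _ mN).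
have cut (B : set T) : measurable B ->
    cmeasurable (fun w => D w * (\1_B w)%:C) /\
    cintegrable P (fun w => D w * (\1_B w)%:C).
  move=> mB; have mDB : cmeasurable (fun w => D w * (\1_B w)%:C).
    by apply: cmeasurableM => //; apply: cmeasurable_real; exact: measurable_indic.
  split=> //; apply: (cintegrable_dominated P _ Z2) => // w.
  by rewrite normrM -[leRHS]mulr1 ler_pM // norm_indicC.
have DE w : D w = \sum_(n < K.+1) D w * (\1_(N @^-1` [set (n : nat)]) w)%:C +
                  D w * (\1_A w)%:C.
  rewrite -mulr_sumr -mulrDr -rmorph_sum -rmorphD /=.
  rewrite -[LHS]mulr1; congr (_ * _); congr (_%:C).
  have [NK|NK] := leqP (N w) K.
    rewrite (bigD1 (Ordinal (NK : (N w < K.+1)%N))) //= indicE mem_set //.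
    rewrite big1 => [|n /eqP nN].
      rewrite indicE memNset /A /= ?addr0 // ltr_nat.
      by apply/negP; rewrite -leqNgt.
    by rewrite indicE memNset //= => Nn; apply: nN; exact/val_inj.
  rewrite big1 => [|n _]; first by rewrite indicE mem_set /A /= ?ltr_nat // add0r.
  rewrite indicE memNset //= => Nn; have := ltn_ord n.
  by rewrite -Nn ltnS leqNgt NK.
have -> : cexpectation P (fun w => Y1 w - Y2 w) =
    cexpectation P (fun w => D w * (\1_A w)%:C).
  under eq_cexpectation do rewrite -/(D _) DE.
  rewrite cexpectationD; last 2 first.
  - by apply: cintegrable_sum => n; have [] := cut _ (mF n).
  - by have [] := cut _ mA.
  rewrite cexpectation_sum => [|n]; last by have [] := cut _ (mF n).
  rewrite big1 ?add0r // => n _.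
  have cut1 (Y : T -> R[i]) : cmeasurable Y -> (forall w, `|Y w| <= (Z w)%:C) ->
      cintegrable P (fun w => Y w * (\1_(N @^-1` [set (n : nat)]) w)%:C).
    move=> mY YZ; apply: (cintegrable_dominated P _ Z) => // [|w].
      apply: cmeasurableM => //; apply: cmeasurable_real.
      exact: measurable_indic.
    by rewrite normrM -[leRHS]mulr1 ler_pM // norm_indicC.
  under eq_cexpectation do rewrite /D mulrBl.
  by rewrite cexpectationB ?Y12 ?subrr //; exact: cut1.
have iZA := integrable_mul_indic P Z2 A iZ2 mA.
apply: (@le_trans _ _ (\int[P]_w (Z2 w * \1_A w))%:C); last by rewrite lecR ltW.
apply: norm_cexpectation_le => //; first by have [] := cut _ mA.
move=> w; have ind0 : 0 <= (\1_A w)%:C :> R[i] by rewrite ler0c indicE ler0n.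
by rewrite normrM (ger0_norm ind0) rmorphM ler_wpM2r.
Qed.

Lemma measurable_random_sum {d : measure_display} {T : measurableType d}
    {R : realType} (P : probability T R) (N : {RV P >-> nat})
    (X : nat -> {RV P >-> R}) : measurable_fun setT (random_sum X N).
Proof.
have -> : [set: T] = \bigcup_n (N @^-1` [set n]).
  by apply/seteqP; split => // w _; exists (N w).
apply/measurable_fun_bigcup => n; first exact: measurable_funPTI.
apply: (eq_measurable_fun (fun w => \sum_(i < n) X i w)) => [w|].
  by rewrite inE /= /random_sum => ->.
exact: measurable_funTS (sum_measurable P X n).
Qed.

Lemma norm_char_fun_le1 {d : measure_display} {T : measurableType d}
    {R : realType} (P : probability T R) (Y : {RV P >-> R}) (u : R) :
  `|char_fun P Y u| <= 1.
Proof.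
apply: (norm_cexpectation_le_cst P _ 1) => [|w]; last by rewrite norm_expi.
apply: cmeasurable_expi; apply: measurable_funM; first exact: measurable_cst.
exact: measurable_funP.
Qed.

(** Both sides have the integrand bounded by N^k, and they agree on each fiber
    of N. *)
Lemma cexpectation_random_sum {d : measure_display} {T : measurableType d}
    {R : realType} (P : probability T R) (N : {RV P >-> nat})
    (X : nat -> {RV P >-> R}) (k : nat) (u : R) :
  mutually_independent P X -> identically_distributed P X ->
  sequence_independent_of P X N ->
  P.-integrable setT (EFin \o (fun w => (N w)%:R ^+ k)) ->
  cexpectation P (fun w => (N w)%:R ^+ k * expi (u * random_sum X N w)) =
  cexpectation P (fun w => (N w)%:R ^+ k * char_fun P (X 0%N) u ^+ N w).
Proof.
move=> X_indep X_ident XN_indep Nk; set phi := char_fun P (X 0%N) u.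
have phi1 : `|phi| <= 1 by exact: norm_char_fun_le1.
have mS : cmeasurable (fun w => expi (u * random_sum X N w)).
  apply: cmeasurable_expi; apply: measurable_funM; first exact: measurable_cst.
  exact: measurable_random_sum.
have normNk w : `|(N w)%:R ^+ k : R[i]| = ((N w)%:R ^+ k)%:C.
  by rewrite ger0_norm ?exprn_ge0 // rmorphXn /= rmorph_nat.
have mNk : cmeasurable (fun w => (N w)%:R ^+ k : R[i]).
  exact: (cmeasurable_nat (fun n => n%:R ^+ k : R[i])).
have mphi : cmeasurable (fun w => phi ^+ N w).
  exact: (cmeasurable_nat (fun n => phi ^+ n)).
apply: (eq_cexpectation_fibers P N _ _ (fun w => (N w)%:R ^+ k)) => //.
- exact: cmeasurableM.
- exact: cmeasurableM.
- by move=> w; rewrite normrM norm_expi mulr1 normNk.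
- move=> w; rewrite normrM normNk ler_piMr ?ler0c ?exprn_ge0 //.
  by rewrite normrX exprn_ile1.
move=> n; have mF : measurable (N @^-1` [set n]) by exact: measurable_funPTI.
have fib (F G : T -> R[i]) : (forall w, N w = n -> F w = G w) ->
    forall w, F w * (\1_(N @^-1` [set n]) w)%:C = G w * (\1_(N @^-1` [set n]) w)%:C.
  move=> FG w; rewrite indicE.
  by have [/set_mem /FG ->//|] := boolP (w \in _); rewrite !mulr0.
have iind : cintegrable P (fun w => (\1_(N @^-1` [set n]) w)%:C : R[i]).
  by apply: cintegrable_real; exact: integrable_indic.
transitivity (cexpectation P (fun w => (n%:R ^+ k * phi ^+ n) *
    (\1_(N @^-1` [set n]) w)%:C)); last first.
  by apply: eq_cexpectation; apply: fib => w ->.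
rewrite cexpectationZ // cexpectation_indic // -mulrA -char_fun_sum_fiber //.
rewrite -cexpectationZ; last first.
  apply: (cintegrable_bounded P _ 1) => [|w].
    apply: cmeasurableM.
      apply: cmeasurable_expi; apply: measurable_funM; first exact: measurable_cst.
      exact: sum_measurable.
    by apply: cmeasurable_real; exact: measurable_indic.
  by rewrite normrM norm_expi mul1r norm_indicC.
apply: eq_cexpectation => w; rewrite [RHS]mulrA.
apply: (fib (fun w => (N w)%:R ^+ k * expi (u * random_sum X N w))
            (fun w => n%:R ^+ k * expi (u * \sum_(i < n) X i w))) => {}w Nn.
by rewrite /random_sum Nn.
Qed.

(** * Riemann-Stieltjes integrals against truncated expectations *)

Section riemann_stieltjes.
Context {d : measure_display} {T : measurableType d} {R : realType}.
Variable P : probability T R.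
Variables (Z S : T -> R) (f : R -> R[i]) (L : R).
Hypothesis Z_ge0 : forall w, 0 <= Z w.
Hypothesis Z_int : P.-integrable setT (EFin \o Z).
Hypothesis S_meas : measurable_fun setT S.
Hypothesis f_meas : cmeasurable (fun w => f (S w)).
Hypothesis f_le1 : forall x, `|f x| <= 1.
Hypothesis L_ge0 : 0 <= L.
Hypothesis f_lip : forall x y, `|f x - f y| <= (L * `|x - y|)%:C.

Let H x w : R := \1_[set w' | S w' <= x] w.
Let m x : R := \int[P]_w (Z w * H x w).

Let HE x w : H x w = (S w <= x)%R%:R.
Proof.
rewrite /H indicE; congr (nat_of_bool _)%:R.
by apply/idP/idP => [/set_mem//|/mem_set].
Qed.

Let mH x : measurable_fun setT (H x).
Proof. exact/measurable_indic/measurable_setle. Qed.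

Let mZ : measurable_fun setT Z.
Proof. by case/integrableP: Z_int => /measurable_EFinP. Qed.

Let iZH x : P.-integrable setT (EFin \o (fun w => Z w * H x w)).
Proof. exact/integrable_mul_indic/measurable_setle. Qed.

Let dH01 x y w : x <= y -> 0 <= H y w - H x w <= 1.
Proof.
move=> xy; rewrite !HE; have [Sx|_] := boolP (S w <= x).
  by rewrite (le_trans Sx xy) subrr lexx ler01.
by rewrite subr0 ler0n lern1 leq_b1.
Qed.

Lemma cintegrable_RS (g : T -> R[i]) (x y : R) : x <= y ->
  cmeasurable g -> (forall w, `|g w| <= 1) ->
  cintegrable P (fun w => (Z w)%:C * (g w * (H y w - H x w)%:C)).
Proof.
move=> xy mg g1; apply: (cintegrable_dominated P _ Z) => // [|w].
  apply: cmeasurableM; first exact: cmeasurable_real.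
  apply: cmeasurableM => //; apply: cmeasurable_real.
  exact: measurable_funB.
have /andP[dH0 dH1] := dH01 x y w xy.
rewrite !normrM !ger0_norm_real_complex // -[leRHS]mulr1 ler_wpM2l ?ler0c //.
by rewrite -[leRHS]mulr1 ler_pM // ?ler0c // lecR.
Qed.

(** The increments of x |-> 1_{S <= x} along the subdivision are nonnegative and
    telescope to 1_{a < S <= M}, and f (t i) differs from f S by at most
    L delta where the i-th increment is nonzero.  The error of a
    Riemann-Stieltjes sum is therefore at most L delta E Z. *)
Lemma is_RS_integral_expectation (a M : R) : a <= M ->
  is_RS_integral f m a M
    (cexpectation P (fun w => (Z w)%:C * (f (S w) * (H M w - H a w)%:C))).
Proof.
move=> aM eps eps0.
pose EZ := \int[P]_w Z w.
have EZ0 : 0 <= EZ by apply: Rintegral_ge0.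
(* The summand 1 keeps the denominator positive and the final bound strict. *)
exists (eps / (L * EZ + 1)) => [|s t s_part s_fine].
  by rewrite divr_gt0 // ltr_wpDl // mulr_ge0.
set delta := eps / _ in s_fine *.
have delta0 : 0 < delta by rewrite divr_gt0 // ltr_wpDl // mulr_ge0.
pose x i := nth a (a :: s) i.
have x_last : x (size s) = M.
  by case: s_part => _ /eqP <-; rewrite /x -last_nth.
have x_le (i : 'I_(size s)) : x i <= x i.+1.
  by have [_ /andP[]] := s_fine i (ltn_ord i); exact: le_trans.
have telescope w : H M w - H a w = \sum_(i < size s) (H (x i.+1) w - H (x i) w).
  rewrite -(big_mkord xpredT (fun i => H (x i.+1) w - H (x i) w)) telescope_sumr //.
  by rewrite x_last.
pose F (i : 'I_(size s)) w := (Z w)%:C * (f (t i) * (H (x i.+1) w - H (x i) w)%:C).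
have iF i : cintegrable P (F i).
  by apply: cintegrable_RS => //; exact: cmeasurable_cst.
have -> : RS_sum f m a s t = cexpectation P (fun w => \sum_(i < size s) F i w).
  rewrite cexpectation_sum //; apply: eq_bigr => i _.
  rewrite -(RintegralB measurableT (iZH _) (iZH _)) -cexpectation_real.
  rewrite -cexpectationZ.
    by apply: eq_cexpectation => w; rewrite /F -mulrBr rmorphM /= mulrCA.
  by under eq_fun do rewrite rmorphB; apply: cintegrableB; exact: cintegrable_real.
rewrite -cexpectationB; [|exact: cintegrable_sum|exact: cintegrable_RS].
apply: (@le_lt_trans _ _ (\int[P]_w (L * delta * Z w))%:C); last first.
  rewrite RintegralZl // ltcR mulrAC /delta mulrA.
  rewrite ltr_pdivrMr ?ltr_wpDl ?mulr_ge0 //.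
  by rewrite mulrC ltr_pM2l // -/EZ ltrDl.
apply: norm_cexpectation_le.
- by apply: cintegrableB; [exact: cintegrable_sum|exact: cintegrable_RS].
- exact: integrable_scaler.
move=> w; rewrite telescope rmorph_sum !mulr_sumr -sumrB.
apply: (@le_trans _ _ (\sum_(i < size s)
    (L * delta * Z w * (H (x i.+1) w - H (x i) w))%:C)); last first.
  rewrite -rmorph_sum lecR -mulr_sumr -telescope.
  have /andP[_ dH1] := dH01 _ _ w aM.
  by rewrite ler_piMr // mulr_ge0 // mulr_ge0 // ltW.
apply: le_trans (ler_norm_sum _ _ _) _; apply: ler_sum => i _.
have /andP[dH0 dH1] := dH01 _ _ w (x_le i).
rewrite /F -mulrBr -mulrBl !normrM !ger0_norm_real_complex //.
rewrite [L * delta * _]mulrC -mulrA [X in _ <= X]rmorphM ler_wpM2l ?ler0c //.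
rewrite rmorphM /=.
(* The increment vanishes unless x_i < S <= x_(i+1). *)
have [xS|Sx] := ltP (x i) (S w); last first.
  by rewrite !HE Sx (le_trans Sx (x_le i)) subrr !mulr0.
have [xS1|Sx1] := ltP (x i.+1) (S w).
  by rewrite !HE !leNgt xS xS1 subrr !mulr0.
rewrite ler_wpM2r ?ler0c //; apply: le_trans (f_lip _ _) _.
rewrite lecR ler_wpM2l // ler_norml.
have [x_delta /andP[xt tx]] := s_fine i (ltn_ord i).
rewrite -/(x i) -/(x i.+1) in x_delta xt tx.
by apply/andP; split; lra.
Qed.

(** The integral up to M misses only the mass of {S <= a} and the tail {S > M}. *)
Lemma is_improper_RS_integral_expectation (a : R) :
  m a = 0 ->
  is_improper_RS_integral f m a (cexpectation P (fun w => (Z w)%:C * f (S w))).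
Proof.
move=> ma0.
exists (fun M =>
  cexpectation P (fun w => (Z w)%:C * (f (S w) * (H M w - H a w)%:C))).
  by move=> M aM; exact: is_RS_integral_expectation.
have if_ : cintegrable P (fun w => (Z w)%:C * f (S w)).
  apply: (cintegrable_dominated P _ Z) => // [|w].
    by apply: cmeasurableM => //; exact: cmeasurable_real.
  by rewrite normrM ger0_norm_real_complex // ler_piMr // ler0c.
apply/cvgrPdist_le => e e0.
have [r r0 rE] := gt0_real_complex e0.
have [K KP] := exists_Rintegral_tail_lt P Z S r Z_int Z_ge0 S_meas r0.
near=> M.
have aM : a <= M by near: M; apply: nbhs_pinfty_ge; exact: num_real.
have KM : K%:R <= M by near: M; apply: nbhs_pinfty_ge; exact: num_real.
have itail := integrable_mul_indic P Z _ Z_int (measurable_setlt S M S_meas).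
rewrite -cexpectationB //; last exact: cintegrable_RS.
apply: (@le_trans _ _ (\int[P]_w (Z w * H a w + Z w * \1_[set w | M < S w] w))%:C).
  apply: norm_cexpectation_le => [||w].
  - by apply: cintegrableB => //; exact: cintegrable_RS.
  - exact: integrable_addr.
  have /andP[dH0 dH1] := dH01 _ _ w aM.
  have tailE : \1_[set w' | M < S w'] w = 1 - H M w.
    rewrite HE leNgt indicE; case: ltP => MS /=.
      by rewrite mem_set // subr0.
    by rewrite memNset ?subrr //= ; apply/negP; rewrite -leNgt.
  rewrite -mulrBr -[X in X - _]mulr1 -mulrBr normrM.
  rewrite ger0_norm_real_complex // -mulrDr.
  rewrite rmorphM /= ler_wpM2l ?ler0c // normrM.
  have -> : 1 - (H M w - H a w)%:C = (H a w + (1 - H M w))%:C.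
    by rewrite !(rmorphB, rmorphD, rmorph1) /=; ring.
  rewrite tailE ger0_norm_real_complex; last by lra.
  by rewrite ler_piMl // ler0c; lra.
rewrite (RintegralD measurableT (iZH a) itail).
by rewrite -/(m a) ma0 add0r rE lecR ltW // KP.
Unshelve. all: by end_near. Qed.

End riemann_stieltjes.

(** * Derivatives of the probability generating function on the closed disk *)

Section power_difference_quotient.
Context {R : realType}.
Implicit Types z w : R[i].

Lemma exprB_quotient z w n : w != z ->
  (w ^+ n - z ^+ n) / (w - z) = \sum_(i < n) w ^+ (n.-1 - i) * z ^+ i.
Proof. by move=> wz; rewrite subrXX mulrAC mulfV ?mul1r // subr_eq0. Qed.

Lemma norm_exprM_le1 z w m n : `|z| <= 1 -> `|w| <= 1 ->
  `|w ^+ m * z ^+ n| <= 1.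
Proof.
by move=> z1 w1; rewrite normrM !normrX -[leRHS]mulr1 ler_pM ?exprn_ile1 ?exprn_ge0.
Qed.

Lemma norm_exprB_quotient_le z w n : `|z| <= 1 -> `|w| <= 1 -> w != z ->
  `|(w ^+ n - z ^+ n) / (w - z)| <= n%:R.
Proof.
move=> z1 w1 wz; rewrite exprB_quotient //; apply: le_trans (ler_norm_sum _ _ _) _.
rewrite -[n in leRHS]card_ord -sumr_const ler_sum // => i _; exact: norm_exprM_le1.
Qed.

Lemma norm_exprB_le z w n : `|z| <= 1 -> `|w| <= 1 ->
  `|w ^+ n - z ^+ n| <= n%:R * `|w - z|.
Proof.
move=> z1 w1; have [->|wz] := eqVneq w z; first by rewrite !subrr normr0 mulr0.
rewrite -ler_pdivrMr ?normr_gt0 ?subr_eq0 // -normf_div.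
exact: norm_exprB_quotient_le.
Qed.

(** Both w^n - z^n over w - z and n z^(n-1) are sums of n monomials of degree
    n - 1; they are compared term by term. *)
Lemma norm_exprB_quotient_deriv_le z w n : `|z| <= 1 -> `|w| <= 1 -> w != z ->
  `|(w ^+ n - z ^+ n) / (w - z) - n%:R * z ^+ n.-1| <= (n * n)%:R * `|w - z|.
Proof.
move=> z1 w1 wz; rewrite exprB_quotient //.
have -> : n%:R * z ^+ n.-1 = \sum_(i < n) z ^+ (n.-1 - i) * z ^+ i.
  rewrite mulr_natl (eq_bigr (fun=> z ^+ n.-1)) ?sumr_const ?card_ord // => i _.
  by rewrite -exprD subnK //; case: (n) i => [[]|n' i] //=; rewrite -ltnS.
rewrite -sumrB; apply: le_trans (ler_norm_sum _ _ _) _.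
have -> : (n * n)%:R * `|w - z| = \sum_(i < n) n%:R * `|w - z|.
  by rewrite sumr_const card_ord natrM -mulrA mulr_natl.
apply: ler_sum => i _; rewrite -mulrBl normrM normrX.
rewrite -[leRHS]mulr1 ler_pM ?exprn_ile1 ?exprn_ge0 //.
apply: le_trans (norm_exprB_le _ _ _ z1 w1) _.
by rewrite ler_wpM2r // ler_nat (leq_trans (leq_subr _ _)) // leq_pred.
Qed.

End power_difference_quotient.

(** By convexity, every point of the disk is approached along the segment to
    another point of the disk.  Limits along this filter are thus unique, which
    gives derivatives within the disk their meaning on the boundary. *)
Lemma closed_unit_disk_proper {R : realType} (z : R[i]) :
  closed_unit_disk z -> ProperFilter (within (closed_unit_disk `\ z) (nbhs z)).
Proof.
move=> z1; apply: within_nbhs_proper => B zB.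
have [p p1 pz] : exists2 p : R[i], `|p| <= 1 & p != z.
  have [z0|z0] := eqVneq z 0.
    by exists 1; rewrite ?normr1 // z0 oner_eq0.
  by exists 0; rewrite ?normr0 // eq_sym.
have [e /= e0 eB] := (nbhs_ballP _ _).1 zB.
have [r r0 rE] := gt0_real_complex e0.
pose t : R := Num.min 1 (r / 4).
have t0 : 0 < t by rewrite lt_min ltr01 divr_gt0.
have t1 : t <= 1 by rewrite ge_min lexx.
have tr : t <= r / 4 by rewrite ge_min lexx orbT.
have t0' := ltW t0; have t1' : 0 <= 1 - t by rewrite subr_ge0.
exists (z + t%:C * (p - z)); split; first split.
- rewrite /closed_unit_disk /=.
  have -> : z + t%:C * (p - z) = (1 - t)%:C * z + t%:C * p.
    by rewrite rmorphB rmorph1; ring.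
  apply: le_trans (ler_normD _ _) _; rewrite !normrM !ger0_norm_real_complex //.
  apply: (@le_trans _ _ ((1 - t)%:C + t%:C)).
    by rewrite lerD // ler_piMr // ler0c.
  by rewrite -rmorphD subrK.
- move=> /= /eqP; rewrite -subr_eq0 addrAC subrr add0r mulf_eq0 subr_eq0 (negPf pz).
  by rewrite orbF fmorph_eq0 gt_eqF.
apply: eB; rewrite -ball_normE /ball_ /= opprD addNKr normrN normrM.
rewrite ger0_norm_real_complex //.
apply: (@le_lt_trans _ _ (t%:C * 2%:R)).
  rewrite ler_wpM2l ?ler0c //; apply: le_trans (ler_normB _ _) _.
  have -> : 2%:R = 1 + 1 :> R[i] by [].
  by apply: lerD.
by rewrite rE -(rmorph_nat (real_complex R)) -rmorphM /= ltcR; lra.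
Qed.

Section factorial_moments.
Context {d : measure_display} {T : measurableType d} {R : realType}.
Variable P : probability T R.
Variables (N : {RV P >-> nat}) (k : nat).
Hypothesis Nk_int : P.-integrable setT (EFin \o (fun w => (N w)%:R ^+ k)).

(** What differentiating E[z^N] j times under the expectation should give. *)
Definition factorial_moment_fun (j : nat) (z : R[i]) : R[i] :=
  cexpectation P (fun w => (N w ^_ j)%:R * z ^+ (N w - j)).

Lemma ffact_le_expn (n j : nat) : (n ^_ j <= n ^ j)%N.
Proof.
elim: j => // j IH; rewrite ffactnSr expnSr; exact: leq_mul IH (leq_subr _ _).
Qed.

Lemma cmeasurable_factorial_moment j (z : R[i]) :
  cmeasurable (fun w => (N w ^_ j)%:R * z ^+ (N w - j)).
Proof. exact: (cmeasurable_nat (fun n => (n ^_ j)%:R * z ^+ (n - j))). Qed.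

Lemma cintegrable_factorial_moment j (z : R[i]) : (j <= k)%N -> `|z| <= 1 ->
  cintegrable P (fun w => (N w ^_ j)%:R * z ^+ (N w - j)).
Proof.
move=> jk z1.
apply: (cintegrable_dominated P _ (fun w => (N w)%:R ^+ k + 1)).
- exact: cmeasurable_factorial_moment.
- by apply: integrable_addr => //; exact: finite_measure_integrable_cst.
(* For j = 0 and N = 0 the integrand is 1 while N^k may be 0, whence the + 1. *)
move=> w; rewrite normrM normr_nat normrX.
apply: (@le_trans _ _ (N w ^_ j)%:R).
  by rewrite ler_piMr // exprn_ile1.
rewrite rmorphD rmorphXn /= rmorph_nat rmorph1 -natrX natr1 ler_nat.
apply: leq_trans (ffact_le_expn _ _) _.
case: (N w) => [|n]; first by case: (j) => [|i]; rewrite ?expn0 ?expnS ?mul0n.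
by rewrite leqW // leq_pexp2l.
Qed.

(** Differentiation under the expectation.  With h = |w - z|, the difference
    between the quotient and the derivative of the integrand is at most
    2 N^(j+1) in all cases, and at most N^(j+2) h.  The first bound is used where
    N > K, where it contributes little to the expectation, the second where
    N <= K, where it is at most K h N^(j+1); both use j + 1 <= k. *)
Lemma cvg_diff_quot_factorial_moment j (z : R[i]) :
  (j < k)%N -> closed_unit_disk z ->
  diff_quot (factorial_moment_fun j) z w
    @[w --> within (closed_unit_disk `\ z) (nbhs z)] -->
  factorial_moment_fun j.+1 z.
Proof.
move=> jk z1; apply/cvgrPdist_le => e e0.
have [r r0 rE] := gt0_real_complex e0.
pose Z w : R := (N w)%:R ^+ k.
have Z0 w : 0 <= Z w by rewrite exprn_ge0.
pose V w : R := (N w)%:R.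
have mV : measurable_fun setT V.
  exact: (measurableT_comp (f := fun n : nat => n%:R : R)).
have r40 : 0 < r / 4 by rewrite divr_gt0.
have [K /(_ _ (lexx _)) tailK] :=
  exists_Rintegral_tail_lt P Z V (r / 4) Nk_int Z0 mV r40.
pose EZ := \int[P]_w Z w.
have EZ0 : 0 <= EZ by exact: Rintegral_ge0.
(* The tail contributes less than 2 (r / 4), the part N <= K at most r / 2. *)
pose delta := r / 2 / (K%:R * EZ + 1).
have KEZ0 : 0 < K%:R * EZ + 1 by rewrite ltr_wpDl // mulr_ge0.
have delta0 : 0 < delta by rewrite !divr_gt0.
have delta0C : 0 < delta%:C :> R[i] by rewrite ltcR.
rewrite near_withinE; near=> w => -[/= w1 /eqP wz].
have : `|z - w| <= delta%:C.
  by apply/ltW; near: w; exact: (@cvgr_dist_lt _ _ _ (nbhs z) _ id z cvg_id).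
rewrite distrC; have [h h0 hE] := norm_real (w - z).
rewrite hE lecR => h_delta.
have iz := cintegrable_factorial_moment j z (ltnW jk) z1.
have iw := cintegrable_factorial_moment j w (ltnW jk) w1.
have iz1 := cintegrable_factorial_moment j.+1 z jk z1.
rewrite /diff_quot /factorial_moment_fun -cexpectationB // mulrC.
have iwz := cintegrableB P _ _ iw iz.
rewrite -cexpectationZ // -cexpectationB //; last exact: cintegrableZ.
pose tail w' : R := Z w' * \1_[set x | K%:R < V x] w'.
have itail : P.-integrable setT (EFin \o tail).
  exact/integrable_mul_indic/measurable_setlt.
have iB : P.-integrable setT (EFin \o (fun w' => 2 * tail w' + K%:R * h * Z w')).
  by apply: integrable_addr; exact: integrable_scaler.
apply: (@le_trans _ _ (\int[P]_w' (2 * tail w' + K%:R * h * Z w'))%:C).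
  apply: norm_cexpectation_le => // [|w'].
    by apply: cintegrableB => //; exact: cintegrableZ.
  set n := (N w' - j)%N.
  have -> : (N w' ^_ j.+1)%:R * z ^+ (N w' - j.+1) -
      (w - z)^-1 * ((N w' ^_ j)%:R * w ^+ n - (N w' ^_ j)%:R * z ^+ n) =
      - ((N w' ^_ j)%:R *
         ((w ^+ n - z ^+ n) / (w - z) - n%:R * z ^+ n.-1)) :> R[i].
    by rewrite ffactnSr subnS -/n natrM; ring.
  rewrite normrN normrM normr_nat.
  have Nj : (N w' ^_ j * n <= N w' ^ k)%N.
    rewrite -ffactnSr; apply: leq_trans (ffact_le_expn _ _) _.
    by case: (N w') => [|m]; [rewrite expnS mul0n|rewrite leq_pexp2l].
  have NjC : (N w' ^_ j)%:R * n%:R <= (Z w')%:C :> R[i].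
    by rewrite /Z rmorphXn /= rmorph_nat -natrX -natrM ler_nat.
  have [KN|NK] := ltnP K (N w').
    apply: (@le_trans _ _ (2 * Z w')%:C); last first.
      rewrite lecR /tail indicE mem_set /V /= ?ltr_nat // mulr1 lerDl.
      by rewrite !mulr_ge0.
    apply: (@le_trans _ _ ((N w' ^_ j)%:R * (n%:R + n%:R))).
      rewrite ler_wpM2l //; apply: le_trans (ler_normB _ _) _.
      rewrite lerD // ?norm_exprB_quotient_le // normrM normr_nat normrX.
      by rewrite ler_piMr // exprn_ile1.
    by rewrite mulrDr (mulr_natl (Z w') 2) mulr2n rmorphD lerD.
  apply: (@le_trans _ _ (K%:R * h * Z w')%:C); last first.
    by rewrite lecR lerDr mulr_ge0 // mulr_ge0 // indicE.
  apply: (@le_trans _ _ ((N w' ^_ j)%:R * ((n * n)%:R * h%:C))).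
    by rewrite ler_wpM2l // -hE norm_exprB_quotient_deriv_le.
  have -> : (N w' ^_ j)%:R * ((n * n)%:R * h%:C) =
      (N w' ^_ j)%:R * n%:R * (n%:R * h%:C) :> R[i] by rewrite natrM; ring.
  have -> : (K%:R * h * Z w')%:C = (Z w')%:C * (K%:R * h%:C) :> R[i].
    rewrite [K%:R * h * _]mulrC rmorphM; congr (_ * _).
    by rewrite rmorphM rmorph_nat.
  have Nj0 : 0 <= (N w' ^_ j)%:R * n%:R :> R[i] by rewrite -natrM.
  have nh0 : 0 <= n%:R * h%:C :> R[i] by rewrite mulr_ge0 // ler0c.
  apply: (ler_pM Nj0 nh0 NjC).
  rewrite ler_wpM2r ?ler0c // ler_nat.
  exact: leq_trans (leq_subr _ _) NK.
rewrite rE lecR RintegralD //; [|exact: integrable_scaler|exact: integrable_scaler].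
rewrite !RintegralZl // -/EZ.
have : K%:R * h * EZ <= r / 2.
  apply: (@le_trans _ _ (delta * (K%:R * EZ + 1))).
    rewrite mulrAC mulrC ler_pM ?mulr_ge0 //.
    by rewrite lerDl.
  by rewrite /delta divfK // gt_eqF.
have : \int[P]_x tail x < r / 4 by exact: tailK.
lra.
Unshelve. all: by end_near. Qed.

Lemma nderive_in_prob_gen_fun j z : (j <= k)%N -> closed_unit_disk z ->
  nderive_in closed_unit_disk j (prob_gen_fun P N) z = factorial_moment_fun j z.
Proof.
elim: j z => [|j IH] z jk z1.
  by apply: eq_cexpectation => w; rewrite ffactn0 mul1r subn0.
have Fz := closed_unit_disk_proper z z1.
rewrite /nderive_in iterS /derive_in; apply: cvg_lim => //.
apply: cvg_trans (cvg_diff_quot_factorial_moment j z jk z1).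
apply: near_eq_cvg; rewrite near_withinE; apply: nearW => w [w1 _].
by rewrite /diff_quot -!/(nderive_in _ _ _ _) !IH // ltnW.
Qed.

Lemma derivable_in_prob_gen_fun j z : (j < k)%N -> closed_unit_disk z ->
  derivable_in closed_unit_disk
    (nderive_in closed_unit_disk j (prob_gen_fun P N)) z.
Proof.
move=> jk z1; apply/cvg_ex; exists (factorial_moment_fun j.+1 z).
apply: cvg_trans (cvg_diff_quot_factorial_moment j z jk z1).
apply: near_eq_cvg; rewrite near_withinE; apply: nearW => w [w1 _].
by rewrite /diff_quot !nderive_in_prob_gen_fun // ltnW.
Qed.

End factorial_moments.

(** * Stirling numbers of the second kind *)

Lemma preim_partition_eqP {k n : nat} (f : {ffun 'I_k -> 'I_n})
    (Q : {set {set 'I_k}}) :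
  finset.partition Q [set: 'I_k]%SET ->
  reflect (forall x y, (finset.pblock Q x == finset.pblock Q y) = (f x == f y))
    (finset.preim_partition f [set: 'I_k]%SET == Q).
Proof.
move=> Qpart; have [/eqP covQ trivQ _] := and3P Qpart.
apply: (iffP eqP) => [<- x y|fQ].
  have [/eqP covF trivF _] := and3P (finset.preim_partitionP f [set: 'I_k]%SET).
  rewrite eq_pblock // ?covF ?inE //.
  rewrite pblock_equivalence_partition ?inE //.
  by split=> // /eqP ->.
rewrite -[RHS](finset.preim_partition_pblock Qpart).
by apply: eq_imset => x; apply/setP => y; rewrite !inE fQ.
Qed.

(** A map whose fibers are the blocks of Q is an injection of the set of blocks
    of Q into the codomain. *)
Lemma card_preim_partition {k n : nat} (Q : {set {set 'I_k}}) :
  finset.partition Q [set: 'I_k]%SET ->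
  #|[set f : {ffun 'I_k -> 'I_n} |
      finset.preim_partition f [set: 'I_k]%SET == Q]%SET| =
    (n ^_ #|Q|)%N.
Proof.
move=> Qpart; have [/eqP covQ trivQ _] := and3P Qpart.
have memQ x : finset.pblock Q x \in Q by rewrite finset.pblock_mem // covQ inE.
pose D := {B | B \in Q}.
pose b x : D := exist _ (finset.pblock Q x) (memQ x).
have b_surj (B : D) : exists x, b x == B.
  case: B => B BQ; have /set0Pn[x xB] : B != finset.set0.
    by apply: contraTneq BQ => ->; case/and3P: Qpart.
  by exists x; rewrite -val_eqE /= (def_pblock trivQ BQ xB).
pose F (g : {ffun D -> 'I_n}) : {ffun 'I_k -> 'I_n} := [ffun x => g (b x)].
have <- : #|{: D}| = #|Q| by rewrite card_sig; apply: eq_card.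
rewrite -[n in RHS]card_ord -card_inj_ffuns -(card_imset _ (_ : injective F)).
  apply: eq_card => f; rewrite inE; apply/preim_partition_eqP/imsetP => //.
    move=> fQ; exists [ffun B => f (xchoose (b_surj B))].
      rewrite inE; apply/injectiveP => B C; rewrite !ffunE => /eqP.
      rewrite -fQ => /eqP eqBC.
      rewrite -(eqP (xchooseP (b_surj B))) -(eqP (xchooseP (b_surj C))).
      exact/val_inj.
    apply/ffunP => x; rewrite !ffunE; apply/eqP; rewrite -fQ.
    by have := xchooseP (b_surj (b x)); rewrite -val_eqE /= eq_sym.
  move=> [g]; rewrite inE => /injectiveP g_inj -> x y.
  by rewrite !ffunE (inj_eq g_inj).
move=> g h /ffunP gh; apply/ffunP => B; have [x /eqP <-] := b_surj B.
by have := gh x; rewrite !ffunE.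
Qed.

(** Sort the n^k maps from a k-set to an n-set by the partition of the source into
    fibers, and the partitions by their number of blocks. *)
Lemma expn_stirling2 (n k : nat) :
  (n ^ k = \sum_(j < k.+1) stirling2 k j * n ^_ j)%N.
Proof.
pose p := [set Q | finset.partition Q [set: 'I_k]%SET]%SET.
have cardQ (Q : {set {set 'I_k}}) : Q \in p -> (#|Q| < k.+1)%N.
  rewrite inE => Qp; have [/eqP covQ trivQ _] := and3P Qp.
  rewrite ltnS; have sumQ : (\sum_(B in Q) #|B| = k)%N.
    by rewrite (eqP trivQ) covQ cardsT card_ord.
  rewrite -[leqRHS]sumQ -sum1_card leq_sum // => B BQ; rewrite card_gt0.
  by apply: contraTneq BQ => ->; case/and3P: Qp.
rewrite -[n in LHS]card_ord -[k in LHS]card_ord -card_ffun -sum1_card.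
rewrite (partition_big (fun f : {ffun 'I_k -> 'I_n} =>
  finset.preim_partition f [set: 'I_k]%SET) (mem p)) /=; last first.
  by move=> f _; rewrite inE finset.preim_partitionP.
rewrite (partition_big (fun Q : {set {set 'I_k}} =>
  inord #|Q| : 'I_k.+1) xpredT) //=.
apply: eq_bigr => j _; rewrite /stirling2 -sum_nat_const.
apply: eq_big => [Q|Q].
  rewrite !inE /=; have [Qp|//] := boolP (finset.partition _ _).
  by rewrite -val_eqE /= inordK // cardQ // inE.
rewrite inE => /andP[Qp /eqP<-]; rewrite sum1dep_card.
by rewrite inordK ?cardQ ?inE // card_preim_partition.
Qed.

(** [expn_stirling2] at n = 0: only the term of index 0 survives. *)
Lemma stirling2_0 (k : nat) : (0 < k)%N -> stirling2 k 0 = 0%N.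
Proof.
move=> k0; have := expn_stirling2 0 k; rewrite exp0n // => /esym/eqP.
rewrite sum_nat_eq0 => /forallP /(_ ord0).
by rewrite /= ffactn0 muln1 => /eqP.
Qed.

(** * The Fourier-Stieltjes transform of the truncated moment *)

(** The distribution function vanishes on the left of 0, hence at 0. *)
Lemma probability_le0 {d : measure_display} {T : measurableType d}
    {R : realType} (P : probability T R) (Y : {RV P >-> R}) :
  (forall w, 0 <= Y w) -> continuous (cdf Y) -> P [set w | Y w <= 0] = 0%E.
Proof.
move=> Y0 cY.
have cdfE r : cdf Y r = P [set w | Y w <= r].
  have -> // : [set w | Y w <= r] = Y @^-1` `]-oo, r].
  by apply/seteqP; split => w /=; rewrite in_itv.
rewrite -cdfE; apply/esym.
apply: (@cvg_unique _ (@ereal_hausdorff R) (cdf Y @ 0^'-)).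
  apply: cvg_near_cst; near=> r.
  rewrite cdfE (_ : [set w | Y w <= r] = set0) ?measure0 //.
  rewrite -subset0 => w /= Yr; have : r < 0 by near: r; exact: nbhs_left_lt.
  by rewrite ltNge (le_trans (Y0 w) Yr).
exact: cvg_at_left_filter (cY 0).
Unshelve. all: by end_near. Qed.

Theorem proposition3p3 (d : measure_display) (T : measurableType d)
    (R : realType) (P : probability T R)
    (N : {RV P >-> nat}) (X : nat -> {RV P >-> R})
    (X_ge0 : forall i w, 0 <= X i w)
    (X_indep : mutually_independent P X)
    (X_ident : identically_distributed P X)
    (X_cont : continuous (cdf (X 0%N)))
    (XN_indep : sequence_independent_of P X N)
    (k : nat) (k_gt0 : (0 < k)%N)
    (Nk_fin : ('E_P[fun w => ((N w)%:R ^+ k)%R] < +oo)%E) :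
  let S := random_sum X N in
  let m := truncated_moment P N S k in
  let phi := char_fun P (X 0%N) in
  let G := prob_gen_fun P N in
  (forall (j : nat) (z : R[i]), (j < k)%N -> closed_unit_disk z ->
     derivable_in closed_unit_disk (nderive_in closed_unit_disk j G) z) /\
  forall u : R,
    is_improper_RS_integral (fun x => expi (u * x)) m 0
      (cexpectation P (fun w => (N w)%:R ^+ k * phi u ^+ N w)) /\
    cexpectation P (fun w => (N w)%:R ^+ k * phi u ^+ N w) =
      \sum_(1 <= j < k.+1)
        (stirling2 k j)%:R * phi u ^+ j
          * nderive_in closed_unit_disk j G (phi u).
Proof.
move=> S m phi G.
pose Z w : R := (N w)%:R ^+ k.
have Z0 w : 0 <= Z w by rewrite exprn_ge0.
have mZ : measurable_fun setT Z.
  exact: (measurableT_comp (f := fun n : nat => n%:R ^+ k : R)).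
have iZ : P.-integrable setT (EFin \o Z).
  apply/integrableP; split; first exact/measurable_EFinP.
  move: Nk_fin; rewrite unlock; congr (_ < _)%E.
  by apply: eq_integral => w _ /=; rewrite ger0_norm.
have mS : measurable_fun setT S by exact: measurable_random_sum.
split=> [j z jk z1|u]; first exact: derivable_in_prob_gen_fun iZ _ _ jk z1.
have phi1 : `|phi u| <= 1 by exact: norm_char_fun_le1.
have mexpi : cmeasurable (fun w => expi (u * S w)).
  by apply: cmeasurable_expi; apply: measurable_funM; first exact: measurable_cst.
split.
  have -> : cexpectation P (fun w => (N w)%:R ^+ k * phi u ^+ N w) =
      cexpectation P (fun w => (Z w)%:C * expi (u * S w)).
    rewrite -cexpectation_random_sum //; apply: eq_cexpectation => w.
    by rewrite rmorphXn /= rmorph_nat.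
  have -> : m = fun x => \int[P]_w (Z w * \1_[set w' | S w' <= x] w).
    by apply/funext => x; rewrite /m /truncated_moment unlock.
  apply: (is_improper_RS_integral_expectation P Z S (fun x => expi (u * x))
    (2 * `|u|)) => //.
  - by move=> x; rewrite norm_expi.
  - move=> x y; apply: le_trans (expi_lipschitz _ _) _.
    by rewrite -mulrBr normrM mulrA.
  have mX0 : measurable [set w | X 0%N w <= 0].
    by apply: measurable_setle; exact: measurable_funP.
  have iZ0 := integrable_mul_indic P Z _ iZ (measurable_setle S 0 mS).
  rewrite /Rintegral (negligible_integral mX0 measurableT iZ0); last first.
    by apply: probability_le0 => // w; exact: X_ge0.
  rewrite integral0_eq // => w [_ /= X0w]; congr _%:E.
  have [N0|N0] := posnP (N w); first by rewrite /Z N0 expr0n gtn_eqF // mul0r.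
  rewrite indicE memNset ?mulr0 //= => Sw; apply: X0w; apply: le_trans Sw.
  by rewrite /S /random_sum (bigD1 (Ordinal N0)) //= lerDl sumr_ge0.
have term (j : 'I_k.+1) : cintegrable P (fun w => (stirling2 k j)%:R * phi u ^+ j *
    ((N w ^_ j)%:R * phi u ^+ (N w - j))).
  apply: cintegrableZ; apply: (cintegrable_factorial_moment P N k iZ) => //.
  by rewrite -ltnS.
(* The term of index 0 vanishes since k > 0. *)
transitivity (\sum_(0 <= j < k.+1) (stirling2 k j)%:R * phi u ^+ j *
    nderive_in closed_unit_disk j G (phi u)); last first.
  by rewrite big_ltn // stirling2_0 // mulr0n !mul0r add0r.
rewrite big_mkord.
under [RHS]eq_bigr => j _.
  have jk : (j <= k)%N by rewrite -ltnS.
  rewrite (nderive_in_prob_gen_fun P N k iZ) // -cexpectationZ; last first.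
    exact: (cintegrable_factorial_moment P N k iZ).
  over.
rewrite -cexpectation_sum //; apply: eq_cexpectation => w.
rewrite -natrX expn_stirling2 natr_sum mulr_suml; apply: eq_bigr => j _.
(* N^_j phi^N = phi^j (N^_j phi^(N-j)), also where N < j, both sides being 0. *)
have [jN|Nj] := leqP j (N w).
  have -> : phi u ^+ N w = phi u ^+ j * phi u ^+ (N w - j).
    by rewrite -exprD subnKC.
  by rewrite natrM; ring.
by rewrite ffact_small // muln0 mul0r !mulr0n mul0r mulr0.
Qed.
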